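(* Let $\phi\ne1$. Suppose that $\eta^2(\nu)$ is quadratic in $\nu$, that $m_1(\nu)$ and $\eta(\nu)m_2(\nu)$ are linear in $\nu$, and that $m_2^2(\nu)$ is a constant. Suppose $h(\nu)$ is conjectured in the exponential-polynomial form such that $$\omega(x,\nu)=\frac{x^{1-\gamma}}{1-\gamma}h(\nu)^{-\frac{1-\gamma}{1-\phi}}=\frac{x^{1-\gamma}}{1-\gamma}\exp\left\{-\frac{1-\gamma}{1-\phi}\left(A_0+\sum_{k=1}^n\frac1kA_k\nu^k\right)\right\},$$ where $A_k$, $k=0,\dots,n$, are constants. Then the equation $$r-\beta^\phi h^{-1}+\frac{1}{2\gamma}\eta^2(\nu)+\frac{\beta\phi}{\phi-1}\left(\beta^{\phi-1}h^{-1}-1\right)-\frac{1}{1-\phi}\left[m_1(\nu)+\frac{\eta(\nu)}{\gamma}\rho m_2(\nu)(1-\gamma)\right]\frac{h_\nu}{h}+\frac{1}{2(1-\phi)^2}m_2^2(\nu)\left[2-\phi-\gamma+\frac{\rho^2(1-\gamma)^2}{\gamma}\right]\frac{h_\nu^2}{h^2}-\frac{1}{2(1-\phi)}m_2^2(\nu)\frac{h_{\nu\nu}}{h}=0$$ has no approximate solutions (of this form) under the log-linear approximation method when the order $n$ of the polynomial is higher than $2$.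
   Context: Parameters: $r>0$, $\beta>0$, $\gamma>0$ with $\gamma\neq1$, $\phi>0$ with $\phi\ne1$ (elasticity of intertemporal substitution), $\rho\in[-1,1]$; $\eta,m_1,m_2$ are real functions of the state variable $\nu$, where $d\nu_t=m_1(\nu_t)dt+m_2(\nu_t)dW^\nu_t$, $m_2$ is the volatility of the state variable and $\eta(\nu_t)$ is the market price of risk. ''Linear in $\nu$'' means a first-order polynomial $a+b\nu$. Equations are to hold identically in $\nu$ on the state space. The displayed equation arises from the infinite-horizon consumption–investment problem with Epstein–Zin recursive utility, $\phi\ne1$, via the ansatz $\omega(x,\nu)=\frac{x^{1-\gamma}}{1-\gamma}h(\nu)^{-\frac{1-\gamma}{1-\phi}}$; the corresponding optimal consumption is $c^*_t=\beta^\phi h^{-1}x$, where $x$ is wealth. Log-linear approximation method: the term $\beta^\phi h^{-1}=c^*_t/x$ is replaced everywhere by its first-order approximation $$\beta^\phi h^{-1}\approx\zeta_1+\zeta_2(\ln c_t^*-\ln x)=\zeta_1+\zeta_2(\phi\ln\beta-\ln h),$$ where $\zeta_1=\exp\{\mathbb{E}(\ln c^*_t-\ln x)\}\left[1-\mathbb{E}(\ln c^*_t-\ln x)\right]$ and $\zeta_2=\exp\{\mathbb{E}(\ln c^*_t-\ln x)\}$ are constants, with $\mathbb{E}(\ln c^*_t-\ln x)$ the (long-horizon) mean of the log consumption–wealth ratio. An approximate solution under the log-linear approximation method is a function $h$ (here of the stated exponential-polynomial form) satisfying the equation after this replacement, in which $\beta^{\phi-1}h^{-1}=\beta^{-1}\cdot\beta^\phi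 h^{-1}$ is replaced accordingly. The polynomial $A_0+\sum_{k=1}^n\frac1kA_k\nu^k$ has order $n$ when $A_n\neq0$.
   Formalization: The volatility $m_2$ of the state variable is assumed nonzero; with $m_2=0$ the claim fails, e.g. $\eta=0$, $m_1=b\nu$, $\nu_t\equiv0$, $b=\zeta_2/n$, $h=\exp(A_0+D\nu^n)$ with $\beta^\phi e^{-A_0}=\beta\phi-r(\phi-1)>0$. *)

(* Defs.v *)
From HB Require Import structures.
From mathcomp Require Import all_boot all_order all_algebra.
From mathcomp Require Import all_classical all_reals all_analysis.

Set Implicit Arguments.
Unset Strict Implicit.
Unset Printing Implicit Defensive.

Import Order.TTheory GRing.Theory Num.Theory.
Import numFieldNormedType.Exports.

Local Open Scope classical_set_scope.
Local Open Scope ring_scope.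

Record market (R : realType) := Market {
  rate : R;                (* r *)
  discount : R;            (* beta *)
  risk_aversion : R;       (* gamma *)
  eis : R;                 (* phi *)
  corr : R;                (* rho *)
  risk_price : R -> R;     (* eta *)
  state_drift : R -> R;    (* m_1 *)
  state_vol : R -> R;      (* m_2 *)
  state_space : set R }.

(* Degenerate coefficients are allowed in the next three definitions. *)
Definition constant_on (R : realType) (D : set R) (f : R -> R) : Prop :=
  exists a : R, forall nu, D nu -> f nu = a.

Definition linear_on (R : realType) (D : set R) (f : R -> R) : Prop :=
  exists a b : R, forall nu, D nu -> f nu = a + b * nu.

Definition quadratic_on (R : realType) (D : set R) (f : R -> R) : Prop :=
  exists a b c : R, forall nu, D nu -> f nu = a + b * nu + c * nu ^+ 2.

Section Equation.
Context {R : realType} (M : market R).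

Let r := rate M.
Let beta := discount M.
Let gamma := risk_aversion M.
Let phi := eis M.
Let rho := corr M.
Let eta := risk_price M.
Let m1 := state_drift M.
Let m2 := state_vol M.
Let D := state_space M.

Definition optimal_consumption (h : R -> R) (x nu : R) : R :=
  beta `^ phi * (h nu)^-1 * x.

Definition log_consumption_wealth (h : R -> R) (nu : R) : R :=
  phi * ln beta - ln (h nu).

Lemma log_consumption_wealthE (h : R -> R) (x nu : R) :
  0 < beta -> 0 < x -> 0 < h nu ->
  ln (optimal_consumption h x nu) - ln x = log_consumption_wealth h nu.
Proof.
move=> b0 x0 h0; rewrite /optimal_consumption /log_consumption_wealth.
have p0 : 0 < beta `^ phi by exact: powR_gt0.
rewrite lnM ?posrE ?mulr_gt0 ?invr_gt0// addrK.
by rewrite lnM ?posrE ?invr_gt0// lnV ?posrE// ln_powR.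
Qed.

(* The left-hand side of the equation, with [y] for beta^phi h^{-1} and [z]
   for beta^(phi-1) h^{-1}. *)
Definition hjb_lhs_with (y z : R) (h : R -> R) (nu : R) : R :=
  r - y + 1 / (2 * gamma) * eta nu ^+ 2
  + beta * phi / (phi - 1) * (z - 1)
  - 1 / (1 - phi)
    * (m1 nu + eta nu / gamma * rho * m2 nu * (1 - gamma))
    * (derive1 h nu / h nu)
  + 1 / (2 * (1 - phi) ^+ 2) * m2 nu ^+ 2
    * (2 - phi - gamma + rho ^+ 2 * (1 - gamma) ^+ 2 / gamma)
    * (derive1 h nu ^+ 2 / h nu ^+ 2)
  - 1 / (2 * (1 - phi)) * m2 nu ^+ 2 * (derive1n 2 h nu / h nu).

Definition hjb_lhs (h : R -> R) (nu : R) : R :=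
  hjb_lhs_with (beta `^ phi * (h nu)^-1) (beta `^ (phi - 1) * (h nu)^-1) h nu.

(* [l] stands for the mean of the log consumption-wealth ratio. *)
Definition zeta1 (l : R) : R := expR l * (1 - l).
Definition zeta2 (l : R) : R := expR l.

Definition loglin_consumption_wealth (l : R) (h : R -> R) (nu : R) : R :=
  zeta1 l + zeta2 l * log_consumption_wealth h nu.

Definition loglin_hjb_lhs (l : R) (h : R -> R) (nu : R) : R :=
  let y := loglin_consumption_wealth l h nu in
  hjb_lhs_with y (beta^-1 * y) h nu.

(* Both replacements in [loglin_hjb_lhs] are the same one. *)
Lemma hjb_lhsE (h : R -> R) (nu : R) : 0 < beta ->
  hjb_lhs h nu =
  let y := beta `^ phi * (h nu)^-1 in hjb_lhs_with y (beta^-1 * y) h nu.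
Proof.
move=> b0; rewrite /hjb_lhs /=; congr (hjb_lhs_with _ _ h nu).
rewrite mulrA powRD; last by rewrite (gt_eqF b0) implybT.
by rewrite powR_inv1 ?ltW// [beta^-1 * _]mulrC.
Qed.

(* [nu t] is the state at time [t]. *)
Definition long_horizon_mean d (T : measurableType d) (P : probability T R)
    (nu : R -> {RV P >-> R}) (h : R -> R) (l : R) : Prop :=
  (forall t, 0 <= t ->
    P.-integrable setT (fun w => (log_consumption_wealth h (nu t w))%:E)) /\
  (fun t => 'E_P[(fun w => log_consumption_wealth h (nu t w))]%E) @ +oo
    --> l%:E.

(* A fixed point: the constants of the approximation depend on [h]. *)
Definition loglin_approx_solution d (T : measurableType d)
    (P : probability T R) (nu : R -> {RV P >-> R}) (h : R -> R) : Prop :=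
  (forall v, D v -> 0 < h v) /\
  exists l : R, long_horizon_mean nu h l /\
    forall v, D v -> loglin_hjb_lhs l h v = 0.

Definition value_ansatz (h : R -> R) (x nu : R) : R :=
  x `^ (1 - gamma) / (1 - gamma) * h nu `^ (- ((1 - gamma) / (1 - phi))).

Definition expo_poly (A : nat -> R) (n : nat) (nu : R) : R :=
  A 0%N + \sum_(1 <= k < n.+1) k%:R^-1 * A k * nu ^+ k.

Definition exp_poly_form (A : nat -> R) (n : nat) (h : R -> R) : Prop :=
  forall x v, 0 < x -> D v ->
    value_ansatz h x v =
    x `^ (1 - gamma) / (1 - gamma)
    * expR (- ((1 - gamma) / (1 - phi)) * expo_poly A n v).

End Equation.

(* Main.v *)
Require Import Defs.
From HB Require Import structures.
From mathcomp Require Import all_boot all_order all_algebra.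
From mathcomp Require Import all_classical all_reals all_analysis.
From mathcomp Require Import ring lra zify.
From mathcomp Require polyorder.
Import Order.TTheory GRing.Theory Num.Theory.
Import numFieldNormedType.Exports.
Local Open Scope classical_set_scope.
Local Open Scope ring_scope.

(** The reason is a degree count.  On the state space the ansatz forces
    [h = exp p] with [p] a polynomial of degree [n], so [h_nu / h = p'] and
    [h_nunu / h = p'' + p'^2], while the log-linear approximation turns the
    consumption-wealth ratio into an affine function of [ln h = p].  The
    equation thereby becomes a Riccati identity between polynomials,
      [k p'^2 + L p' + k1 p'' + k0 p + B = 0],
    with [deg L <= 1] and [deg B <= 2] ([loglin_hjb_lhs_riccati]).  Holding on
    a nonempty open set, it holds identically ([poly_eq0_on_open]).

    The coefficient [k] collects the contributions of both [h_nu^2 / h^2] and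
    [h_nunu / h].  With [s = m_2^2] it simplifies to
      [k = s (1 - gamma) (gamma (1 - rho^2) + rho^2)
           / (2 (1 - phi)^2 gamma)],
    which does not vanish ([square_gradient_coef_neq0]).  Hence [k p'^2] has
    degree exactly [2n - 2], every other term has degree at most
    [max(n, 2)], and [2n - 2 > n] as soon as [n > 2]: nothing can cancel the
    leading term ([riccati_poly_neq0]). *)

Set Implicit Arguments.
Unset Strict Implicit.
Unset Printing Implicit Defensive.

Lemma poly_eq0_on_open (R : realType) (D : set R) (Q : {poly R}) :
  open D -> D !=set0 -> (forall v, D v -> Q.[v] = 0) -> Q = 0.
Proof.
move=> Dopen [a Da] Q0.
have [e /= e0 aD] : exists2 e : R, 0 < e & ball a e `<=` D.
  by have /nbhs_ballP[e] : nbhs a D by [exact: open_nbhs_nbhs]; exists e.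
(* The distinct points a + e / (i + 2) stay in the ball and outnumber
   the possible roots of a nonzero Q. *)
pose f i : R := a + e / i.+2%:R.
apply: (@roots_geq_poly_eq0 _ Q (mkseq f (size Q))).
- apply/allP => _ /mapP[i _ ->]; apply/eqP/Q0/aD.
  rewrite /ball /= opprD addNKr normrN gtr0_norm ?divr_gt0//.
  by rewrite ltr_pdivrMr// ltr_pMr// ltr1n.
- rewrite map_inj_uniq ?iota_uniq// => i j /addrI /(mulfI (lt0r_neq0 e0)).
  by move=> /invr_inj /eqP; rewrite eqr_nat => /eqP[].
- by rewrite size_mkseq.
Qed.

(** The square term has size [2 * size P - 3], the others together at most
    [size P]; the former is larger exactly when [3 < size P], that is, when
    [P] has degree at least 3.  At degree 2 both sizes agree and the leading
    terms may cancel. *)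
Lemma riccati_poly_neq0 (R : realDomainType) (P L B : {poly R}) (k k1 k0 : R) :
  (3 < size P)%N -> (size L <= 2)%N -> (size B <= 3)%N -> k != 0 ->
  k *: P^`() ^+ 2 + (L * P^`() + k1 *: P^`()^`() + k0 *: P + B) != 0.
Proof.
move=> P3 L2 B3 k_neq0.
have szP' := polyorder.size_deriv P.
have P'_neq0 : P^`() != 0 by rewrite -size_poly_eq0 szP'; lia.
have sz_sq : size (k *: P^`() ^+ 2) = (size P + (size P - 3))%N.
  by rewrite size_scale// expr2 size_mul// szP'; lia.
have sz_rest :
    (size (L * P^`() + k1 *: P^`()^`() + k0 *: P + B)%R <= size P)%N.
  rewrite (leq_trans (size_polyD _ _))// geq_max (leq_trans B3 (ltnW P3)) andbT.
  rewrite (leq_trans (size_polyD _ _))// geq_max size_scale_leq andbT.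
  rewrite (leq_trans (size_polyD _ _))// geq_max; apply/andP; split.
    by rewrite (leq_trans (size_polyMleq _ _))// szP'; lia.
  rewrite (leq_trans (size_scale_leq _ _))// !polyorder.size_deriv; lia.
by rewrite -size_poly_eq0 size_polyDl sz_sq; lia.
Qed.

(** The functions [Q exp P] are stable under differentiation, so this formula
    can be iterated to reach the second derivative of [exp P]. *)
Lemma derive1_poly_expR (R : realType) (P Q : {poly R}) (v : R) :
  derive1 (fun u => Q.[u] * expR P.[u]) v
  = (Q^`() + Q * P^`()).[v] * expR P.[v].
Proof.
have dE := is_derive1_comp (is_derive_expR P.[v]) (is_derive_poly P v).
rewrite derive1E (@derive_val _ _ _ _ _ _ _ (is_deriveM (is_derive_poly Q v) dE)).
by rewrite !hornerE /GRing.scale /=; ring.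
Qed.

Lemma eq_derive1_open (R : realType) (D : set R) (f g : R -> R) :
  open D -> (forall v, D v -> f v = g v) ->
  forall v, D v -> derive1 f v = derive1 g v.
Proof.
move=> Dopen fg v Dv; rewrite !derive1E; apply: near_eq_derive.
have : nbhs v D by exact: open_nbhs_nbhs.
exact: filterS fg.
Qed.

(** Openness of [D] matters here: [h] is prescribed on [D] only, and its
    derivatives at a point of [D] depend on a neighbourhood of that point. *)
Lemma log_derive_expR_poly (R : realType) (D : set R) (h : R -> R)
    (P : {poly R}) :
  open D -> (forall v, D v -> h v = expR P.[v]) ->
  forall v, D v ->
    derive1 h v / h v = P^`().[v] /\
    derive1n 2 h v / h v = P^`()^`().[v] + P^`().[v] ^+ 2.
Proof.
move=> Dopen hE.
have h'E v : D v -> derive1 h v = P^`().[v] * expR P.[v].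
  move=> Dv; rewrite (eq_derive1_open (g := fun u => (1 : {poly R}).[u] * expR P.[u]) Dopen)//.
    by rewrite derive1_poly_expR derivC add0r mul1r.
  by move=> u Du; rewrite hornerC mul1r hE.
move=> v Dv; rewrite /derive1n /= (eq_derive1_open Dopen h'E)//.
rewrite derive1_poly_expR h'E// hE// !mulfK ?expR_eq0//; split=> //.
by rewrite !hornerE expr2.
Qed.

Definition expo_polyP (R : realType) (A : nat -> R) (n : nat) : {poly R} :=
  \poly_(i < n.+1) (if i is 0 then A 0%N else i%:R^-1 * A i).

Lemma horner_expo_polyP (R : realType) (A : nat -> R) (n : nat) (v : R) :
  (expo_polyP A n).[v] = expo_poly A n v.
Proof.
rewrite horner_poly big_ord_recl expr0 mulr1; congr (_ + _).
by rewrite big_add1 big_mkord.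
Qed.

Lemma size_expo_polyP (R : realType) (A : nat -> R) (n : nat) :
  (0 < n)%N -> A n != 0 -> size (expo_polyP A n) = n.+1.
Proof.
move=> n0 An; apply: size_poly_eq.
by case: n n0 An => // n _ An; rewrite mulf_neq0// invr_neq0// pnatr_eq0.
Qed.

(** The value function determines [h]: its exponent
    [- (1 - gamma) / (1 - phi)] is nonzero, so it can be cancelled after
    taking logarithms. *)
Lemma exp_poly_formE (R : realType) (M : market R) (A : nat -> R) (n : nat)
    (h : R -> R) :
  risk_aversion M != 1 -> eis M != 1 ->
  (forall v, state_space M v -> 0 < h v) -> exp_poly_form M A n h ->
  forall v, state_space M v -> h v = expR (expo_poly A n v).
Proof.
move=> g1 f1 h0 hA v Dv; have := hA 1 v ltr01 Dv.
have g1' : 1 - risk_aversion M != 0 by rewrite subr_eq0 eq_sym.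
have f1' : 1 - eis M != 0 by rewrite subr_eq0 eq_sym.
rewrite /value_ansatz powR1 => /mulfI; rewrite mul1r invr_eq0 => /(_ g1').
rewrite /powR (gt_eqF (h0 v Dv)) => /expR_inj /mulfI.
rewrite oppr_eq0 mulf_neq0 ?invr_neq0// => /(_ isT) <-.
by rewrite lnK// posrE h0.
Qed.

(** The coefficient of [p'^2] in the equation for [h = exp p]: the second
    summand comes from [h_nunu / h], which contains a [p'^2] of its own. *)
Definition square_gradient_coef (R : realFieldType) (gamma phi rho s : R) : R :=
  1 / (2 * (1 - phi) ^+ 2) * s
    * (2 - phi - gamma + rho ^+ 2 * (1 - gamma) ^+ 2 / gamma)
  - 1 / (2 * (1 - phi)) * s.

(** The two contributions combine so that [phi] remains only in the
    denominator, leaving the factors [1 - gamma] and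
    [gamma (1 - rho^2) + rho^2]; the latter is positive because it is a convex
    combination of [gamma > 0] and [1]. *)
Lemma square_gradient_coef_neq0 (R : realFieldType) (gamma phi rho s : R) :
  0 < gamma -> gamma != 1 -> phi != 1 -> -1 <= rho <= 1 -> s != 0 ->
  square_gradient_coef gamma phi rho s != 0.
Proof.
move=> g0 g1 f1 /andP[r1 r2] s0.
have g_neq0 := lt0r_neq0 g0.
have g1' : 1 - gamma != 0 by rewrite subr_eq0 eq_sym.
have f1' : 1 - phi != 0 by rewrite subr_eq0 eq_sym.
have -> : square_gradient_coef gamma phi rho s
  = s * (1 - gamma) * (gamma * (1 - rho ^+ 2) + rho ^+ 2)
    / (2 * (1 - phi) ^+ 2 * gamma).
  by rewrite /square_gradient_coef; field; rewrite g_neq0 f1'.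
have pos : 0 < gamma * (1 - rho ^+ 2) + rho ^+ 2.
  have [->|rho0] := eqVneq rho 0; first by rewrite expr0n subr0 mulr1 addr0.
  have : 0 < rho ^+ 2 by rewrite exprn_even_gt0.
  have : 0 <= 1 - rho ^+ 2 by nra.
  by move=> /(mulr_ge0 (ltW g0)); lra.
rewrite !(mulf_eq0, invr_eq0, expf_eq0, negb_or) s0 g1' f1' g_neq0 pnatr_eq0.
by rewrite (lt0r_neq0 pos).
Qed.

(** Both occurrences of the consumption-wealth ratio [y] combine into
    [- y + phi / (phi - 1) y = y / (phi - 1)], and [y] is affine in [p], so
    they contribute only to [k0] and to the constant term of [B].  The rest of
    [B] comes from [eta^2], and [L] from [m_1] and [eta m_2]. *)
Lemma loglin_hjb_lhs_riccati (R : realType) (M : market R) (l : R)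
    (h : R -> R) (P : {poly R}) (s : R) :
  0 < discount M -> 0 < risk_aversion M -> eis M != 1 ->
  open (state_space M) ->
  quadratic_on (state_space M) (fun v => risk_price M v ^+ 2) ->
  linear_on (state_space M) (state_drift M) ->
  linear_on (state_space M) (fun v => risk_price M v * state_vol M v) ->
  (forall v, state_space M v -> state_vol M v ^+ 2 = s) ->
  (forall v, state_space M v -> h v = expR P.[v]) ->
  exists L B : {poly R}, exists k1 k0 : R,
    [/\ (size L <= 2)%N, (size B <= 3)%N & forall v, state_space M v ->
      loglin_hjb_lhs M l h v =
      (square_gradient_coef (risk_aversion M) (eis M) (corr M) s *: P^`() ^+ 2
       + (L * P^`() + k1 *: P^`()^`() + k0 *: P + B)).[v]].
Proof.
move=> b0 g0 f1 Dopen [a [b [c etaE]]] [a1 [b1 m1E]] [a2 [b2 em2E]] m2E hE.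
have f1' : 1 - eis M != 0 by rewrite subr_eq0 eq_sym.
have b_neq0 := lt0r_neq0 b0; have g_neq0 := lt0r_neq0 g0.
pose q := corr M * (1 - risk_aversion M) / risk_aversion M.
(* w is the constant part of y / (phi - 1), and u the constant term of B. *)
pose w := (zeta1 l + zeta2 l * (eis M * ln (discount M))) / (eis M - 1).
pose u := rate M + a / (2 * risk_aversion M)
          - discount M * eis M / (eis M - 1) + w.
exists (- (1 - eis M)^-1 *: Poly [:: a1 + q * a2; b1 + q * b2]).
exists (Poly [:: u; b / (2 * risk_aversion M); c / (2 * risk_aversion M)]).
exists (- (2 * (1 - eis M))^-1 * s), (zeta2 l / (1 - eis M)).
split; first by rewrite (leq_trans (size_scale_leq _ _))// size_Poly.
  exact: size_Poly.
move=> v Dv.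
have [h1 h2] := log_derive_expR_poly Dopen hE Dv.
rewrite /loglin_hjb_lhs /hjb_lhs_with -expr_div_n h1 h2.
rewrite /loglin_consumption_wealth /log_consumption_wealth hE// expRK.
rewrite etaE// m1E// m2E//.
have -> : risk_price M v / risk_aversion M * corr M * state_vol M v
    * (1 - risk_aversion M) = q * (a2 + b2 * v).
  by rewrite -em2E// /q; ring.
rewrite !(hornerE, horner_Poly) /= /u /w /square_gradient_coef.
have f1'' : eis M - 1 != 0 by rewrite subr_eq0.
by field; rewrite g_neq0 f1' f1'' b_neq0.
Qed.

Theorem theorem4p5 (R : realType) (M : market R)
  (rate_gt0 : 0 < rate M)
  (discount_gt0 : 0 < discount M)
  (risk_aversion_gt0 : 0 < risk_aversion M)
  (risk_aversion_neq1 : risk_aversion M != 1)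
  (eis_gt0 : 0 < eis M)
  (eis_neq1 : eis M != 1)
  (corr_bound : -1 <= corr M <= 1)
  (state_space_open : open (state_space M))
  (state_space_itv : is_interval (state_space M))
  (state_space_neq0 : state_space M !=set0)
  (eta2_quadratic :
    quadratic_on (state_space M) (fun v => risk_price M v ^+ 2))
  (m1_linear : linear_on (state_space M) (state_drift M))
  (etam2_linear :
    linear_on (state_space M) (fun v => risk_price M v * state_vol M v))
  (m2sq_constant :
    constant_on (state_space M) (fun v => state_vol M v ^+ 2))
  (m2_nondegenerate : forall v, state_space M v -> state_vol M v != 0)
  (d : measure_display) (T : measurableType d) (P : probability T R)
  (nu : R -> {RV P >-> R})
  (nu_state : forall t w, 0 <= t -> state_space M (nu t w))
  (n : nat) (n_gt2 : (2 < n)%N) :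
  ~ exists (A : nat -> R) (h : R -> R),
      [/\ A n != 0, exp_poly_form M A n h & loglin_approx_solution M nu h].
Proof.
case=> A [h [An hA [h0 [l [_ eq0]]]]].
have [s m2E] := m2sq_constant.
have s_neq0 : s != 0.
  by have [v Dv] := state_space_neq0; rewrite -(m2E v)// expf_neq0 ?m2_nondegenerate.
have hE v : state_space M v -> h v = expR (expo_polyP A n).[v].
  by move=> Dv; rewrite horner_expo_polyP (exp_poly_formE _ _ h0 hA).
have [L [B [k1 [k0 [L2 B3 lhsE]]]]] := loglin_hjb_lhs_riccati l
  discount_gt0 risk_aversion_gt0 eis_neq1 state_space_open eta2_quadratic
  m1_linear etam2_linear m2E hE.
have k_neq0 := square_gradient_coef_neq0 risk_aversion_gt0
  risk_aversion_neq1 eis_neq1 corr_bound s_neq0.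
have P3 : (3 < size (expo_polyP A n))%N.
  by rewrite size_expo_polyP// (ltn_trans _ n_gt2).
apply/negP: (riccati_poly_neq0 k1 k0 P3 L2 B3 k_neq0).
apply/negPn/eqP/(poly_eq0_on_open state_space_open state_space_neq0).
by move=> v Dv; rewrite -lhsE// eq0.
Qed.
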